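(* Let $(X,\tau,\mathfrak a)$ be an aura topological space. For $U,V\in\tau_{\mathfrak a}$, define $$U\Rightarrow_{\mathfrak a}V=\{x\in X:(\mathord{\uparrow}_{\mathfrak a}\{x\})\cap U\subseteq V\}.$$ Then $U\Rightarrow_{\mathfrak a}V\in\tau_{\mathfrak a}$, and it is the largest $W\in\tau_{\mathfrak a}$ satisfying $W\cap U\subseteq V$. Therefore the (Heyting) implication in $\mathsf L_{\mathfrak a}(X)$ is given, for all $A,B\subseteq X$, by $$[A]\Rightarrow[B]=\bigl[K_{\mathfrak a}(A)\Rightarrow_{\mathfrak a}K_{\mathfrak a}(B)\bigr].$$
   Context: $X$ is a nonempty set. An aura topological space is a triple $(X,\tau,\mathfrak a)$ where $(X,\tau)$ is a topological space and $\mathfrak a:X\to\tau$ (the scope function) satisfies $x\in\mathfrak a(x)$ for every $x\in X$. A set $U\subseteq X$ is $\mathfrak a$-open (aura-open) if $\{x\in U:\mathfrak a(x)\subseteq U\}=U$; the family of all $\mathfrak a$-open sets is denoted $\tau_{\mathfrak a}$ and is known to be a topology on $X$. The scope relation is $xR_{\mathfrak a}y\iff y\in\mathfrak a(x)$, $\preccurlyeq_{\mathfrak a}$ is its reflexive-transitive closure, and $\mathord{\uparrow}_{\mathfrak a}\{x\}=\{y\in X:x\preccurlyeq_{\mathfrak a}y\}$. For $A,B\subseteq X$, $A\equiv_{\mathfrak a}B$ means that for every $U\in\tau_{\mathfrak a}$, $A\subseteq U\iff B\subseteq U$. The canonical hull is $K_{\mathfrak a}(A)=\bigcap\{U\in\tau_{\mathfrak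 a}:A\subseteq U\}$, which belongs to $\tau_{\mathfrak a}$. $\mathsf L_{\mathfrak a}(X)=\mathcal P(X)/{\equiv_{\mathfrak a}}$ is the set of equivalence classes $[A]$, ordered by $[A]\le[B]\iff K_{\mathfrak a}(A)\subseteq K_{\mathfrak a}(B)$; this ordered set is a complete frame, hence a complete Heyting algebra, whose implication $[A]\Rightarrow[B]$ is the largest class $[C]$ with $[C]\wedge[A]\le[B]$. *)

(* Defs.v *)
From HB Require Import structures.
From Stdlib Require Import Relation_Operators.
From mathcomp Require Import all_boot all_order.
From mathcomp Require Import boolp classical_sets topology.
From mathcomp Require Import generic_quotient.

Set Implicit Arguments.
Unset Strict Implicit.
Unset Printing Implicit Defensive.

Import Order.TTheory.

Local Open Scope classical_set_scope.
Local Open Scope quotient_scope.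

Record scope_function (X : topologicalType) := ScopeFunction {
  scope_fun :> X -> set X ;
  scope_fun_open : forall x, open (scope_fun x) ;
  scope_fun_mem : forall x, scope_fun x x }.

Section AuraTopology.
Variables (X : topologicalType) (a : scope_function X).
Implicit Types (A B U V : set X).

Definition aura_open : set (set X) :=
  [set U | [set x | U x /\ a x `<=` U] = U].

Definition scope_rel (x y : X) : Prop := a x y.

Definition scope_preorder : X -> X -> Prop := clos_refl_trans X scope_rel.

Definition scope_up (x : X) : set X := [set y | scope_preorder x y].

Definition aura_imp U V : set X := [set x | scope_up x `&` U `<=` V].

Definition aura_equiv A B : Prop :=
  forall U, aura_open U -> (A `<=` U <-> B `<=` U).

Definition hull A : set X := \bigcap_(U in [set U | aura_open U /\ A `<=` U]) U.

Lemma aura_openP U : aura_open U <-> forall x, U x -> a x `<=` U.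
Proof.
split=> [UE x Ux|Uo]; first by move: Ux; rewrite -{1}UE => -[].
by apply/seteqP; split=> x /= => [[]//|Ux]; split=> //; exact: Uo.
Qed.

Lemma aura_open_bigcap (F : set (set X)) :
  F `<=` aura_open -> aura_open (\bigcap_(U in F) U).
Proof.
move=> Fo; apply/aura_openP => x Fx y axy U FU.
by move/Fo/aura_openP : (FU); apply; [exact: (Fx U FU)|].
Qed.

Lemma aura_open_bigcup (F : set (set X)) :
  F `<=` aura_open -> aura_open (\bigcup_(U in F) U).
Proof.
move=> Fo; apply/aura_openP => x [U FU Ux] y axy; exists U => //.
by move/Fo/aura_openP : (FU); apply; [exact: Ux|].
Qed.

Lemma aura_openI U V : aura_open U -> aura_open V -> aura_open (U `&` V).
Proof.
move=> /aura_openP Uo /aura_openP Vo; apply/aura_openP => x [Ux Vx] y axy.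
by split; [exact: (Uo x)|exact: (Vo x)].
Qed.

Lemma hull_open A : aura_open (hull A).
Proof. by apply: aura_open_bigcap => U []. Qed.

Lemma sub_hull A : A `<=` hull A.
Proof. by move=> x Ax U [_]; apply. Qed.

Lemma hull_min A U : aura_open U -> A `<=` U -> hull A `<=` U.
Proof. by move=> Uo AU x; apply. Qed.

Lemma hull_id U : aura_open U -> hull U = U.
Proof.
by move=> Uo; apply/seteqP; split; [exact: hull_min|exact: sub_hull].
Qed.

Lemma aura_equiv_hull A B : aura_equiv A B <-> hull A = hull B.
Proof.
split=> [AB|AB U Uo].
  apply/seteqP; split; apply: hull_min; try exact: hull_open.
    by apply/(AB _ (hull_open B)); exact: sub_hull.
  by apply/(AB _ (hull_open A)); exact: sub_hull.
have hullP C : C `<=` U <-> hull C `<=` U.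
  split; first exact: hull_min.
  by apply: subset_trans; exact: sub_hull.
by rewrite hullP AB -hullP.
Qed.

Definition aura_equivb : rel (set X) := fun A B => `[< aura_equiv A B >].

Lemma aura_equivb_refl : reflexive aura_equivb.
Proof. by move=> A; apply/asboolP. Qed.

Lemma aura_equivb_sym : symmetric aura_equivb.
Proof.
by move=> A B; apply/asboolP/asboolP => /aura_equiv_hull AB;
  exact/aura_equiv_hull.
Qed.

Lemma aura_equivb_trans : transitive aura_equivb.
Proof.
move=> B A C /asboolP/aura_equiv_hull AB /asboolP/aura_equiv_hull BC.
by apply/asboolP/aura_equiv_hull; rewrite AB.
Qed.

Canonical aura_equiv_rel :=
  EquivRel aura_equivb aura_equivb_refl aura_equivb_sym aura_equivb_trans.

Definition aura_quot := {eq_quot aura_equiv_rel}.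

HB.instance Definition _ := EqQuotient.on aura_quot.
HB.instance Definition _ := Choice.on aura_quot.

Lemma hull_repr A : hull (repr (\pi_aura_quot A)) = hull A.
Proof.
apply/aura_equiv_hull/asboolP.
by have /eqmodP : repr (\pi_aura_quot A) = A %[mod aura_quot] by rewrite reprK.
Qed.

(* The order is read off representatives; aura_leE shows that this does not
   depend on their choice. *)
Definition aura_le (p q : aura_quot) : bool :=
  `[< hull (repr p) `<=` hull (repr q) >].

Lemma aura_le_refl : reflexive aura_le.
Proof. by move=> p; apply/asboolP. Qed.

Lemma aura_le_anti : antisymmetric aura_le.
Proof.
move=> p q /andP[/asboolP pq /asboolP qp].
rewrite -[p]reprK -[q]reprK; apply/eqmodP/asboolP/aura_equiv_hull.
exact/seteqP.
Qed.

Lemma aura_le_trans : transitive aura_le.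
Proof.
move=> q p r /asboolP pq /asboolP qr.
by apply/asboolP; exact: subset_trans qr.
Qed.

Fact aura_display : Order.disp_t. Proof. exact: Order.Disp tt tt. Qed.

HB.instance Definition _ := Order.Le_isPOrder.Build aura_display aura_quot
  aura_le_refl aura_le_anti aura_le_trans.

Lemma aura_leE A B :
  (\pi_aura_quot A <= \pi_aura_quot B)%O = `[< hull A `<=` hull B >].
Proof. by rewrite /Order.le /= /aura_le !hull_repr. Qed.

Definition aura_meet (p q : aura_quot) : aura_quot :=
  \pi_aura_quot (hull (repr p) `&` hull (repr q)).

Lemma hull_meet p q :
  hull (repr (aura_meet p q)) = hull (repr p) `&` hull (repr q).
Proof. by rewrite hull_repr hull_id//; apply: aura_openI; exact: hull_open. Qed.

Lemma aura_lexI (r p q : aura_quot) :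
  (r <= aura_meet p q)%O = (r <= p)%O && (r <= q)%O.
Proof.
rewrite /Order.le /= /aura_le hull_meet -asbool_and.
by apply/asboolP/asboolP; rewrite subsetI.
Qed.

HB.instance Definition _ :=
  Order.POrder_isMeetSemilattice.Build aura_display aura_quot aura_lexI.

End AuraTopology.

Definition is_himp d (L : meetSemilatticeType d) (p q r : L) : Prop :=
  (r `&` p <= q)%O /\ forall s : L, (s `&` p <= q)%O -> (s <= r)%O.

Section AuraHeyting.
Variables (X : topologicalType) (a : scope_function X).

Lemma aura_himp_ex (p q : aura_quot a) : exists r, is_himp p q r.
Proof.
pose F := [set hull a (repr s) | s in [set s : aura_quot a | (s `&` p <= q)%O]].
have Fo : aura_open a (\bigcup_(U in F) U).
  by apply: aura_open_bigcup => _ [s _ <-]; exact: hull_open.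
have FE := hull_id Fo.
exists (\pi_(aura_quot a) (\bigcup_(U in F) U)); split.
  apply/asboolP; rewrite hull_meet hull_repr FE => x [[_ [s sp <-] sx] px].
  by move/asboolP : sp; rewrite hull_meet; apply.
move=> s sp; apply/asboolP; rewrite hull_repr FE => x sx.
by exists (hull a (repr s)) => //; exists s.
Qed.

Definition aura_himp (p q : aura_quot a) : aura_quot a :=
  sval (cid (aura_himp_ex p q)).

Lemma aura_himpP (p q : aura_quot a) : is_himp p q (aura_himp p q).
Proof. exact: svalP (cid (aura_himp_ex p q)). Qed.

End AuraHeyting.

(* Main.v *)
Require Import Defs.
From Stdlib Require Import Relation_Operators.
From mathcomp Require Import all_boot all_order.
From mathcomp Require Import boolp classical_sets topology.
From mathcomp Require Import generic_quotient.

(** The aura-open sets are exactly the up-sets of the preorder generated by the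
    scope relation ([aura_open_up]), so they form an Alexandrov topology, and
    the formula for [aura_imp] is the implication of up-sets familiar from
    Kripke semantics: [x] forces [U => V] when every point above [x] lying in
    [U] lies in [V]. It is an up-set by transitivity, it satisfies modus ponens
    by reflexivity, and it contains every up-set [W] with [W `&` U `<=` V]
    because such a [W] contains everything above each of its points.

    The map [[A] |-> hull a A] identifies the quotient with the lattice of
    aura-open sets, turning meets into intersections ([pi_meet_leE]). The
    universal property of [aura_imp] therefore transfers verbatim to classes,
    where it determines the implication because the order is antisymmetric
    ([is_himp_uniq]). *)

Local Open Scope classical_set_scope.
Local Open Scope quotient_scope.

Lemma is_himp_uniq d (L : meetSemilatticeType d) (p q r s : L) :
  is_himp p q r -> is_himp p q s -> r = s.
Proof.
move=> [rp rmax] [sp smax]; apply/Order.POrderTheory.le_anti.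
by rewrite smax ?rmax.
Qed.

Section AuraImplication.
Variables (X : topologicalType) (a : scope_function X).
Implicit Types (A B C U V W : set X).

(** Being closed under one scope step propagates along finite chains of
    steps. *)
Lemma aura_open_up U x : aura_open a U -> U x -> scope_up a x `<=` U.
Proof.
move=> /aura_openP Uo Ux y xy; elim: xy Ux => //.
- by move=> u v uv /Uo; exact.
- by move=> u v w _ uv _ vw /uv.
Qed.

(** Passing to a point of [a x] shrinks [scope_up], by transitivity, and so
    only weakens the condition defining the implication. *)
Lemma aura_imp_open U V : aura_open a (aura_imp a U V).
Proof.
apply/aura_openP => x xUV y axy z [yz Uz]; apply: xUV; split=> //.
by apply: rt_trans yz; exact: rt_step.
Qed.

Lemma aura_imp_mp U V : aura_imp a U V `&` U `<=` V.
Proof. by move=> x [xUV Ux]; apply: xUV; split=> //; exact: rt_refl. Qed.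

Lemma aura_imp_max U V W :
  aura_open a W -> W `&` U `<=` V -> W `<=` aura_imp a U V.
Proof.
move=> Wo WUV x Wx y [xy Uy]; apply: WUV; split=> //.
exact: aura_open_up Wo Wx _ xy.
Qed.

(** Meet and order of the quotient are read off representatives; since hulls
    are invariant under equivalence and the hull of a meet is the intersection
    of the hulls, any sets in the two classes can be used instead. *)
Lemma pi_meet_leE C A B :
  (\pi_(aura_quot a) C `&` \pi_(aura_quot a) A <= \pi_(aura_quot a) B)%O =
  `[< hull a C `&` hull a A `<=` hull a B >].
Proof.
rewrite [LHS]/(`[< hull a (repr (aura_meet _ _)) `<=` _ >]).
by rewrite hull_meet !hull_repr.
Qed.

(** The implication of two hulls is aura-open, hence its own hull, so both
    halves of the universal property become statements about aura-open sets. *)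
Lemma is_himp_aura_imp A B :
  is_himp (\pi_(aura_quot a) A) (\pi_(aura_quot a) B)
    (\pi_(aura_quot a) (aura_imp a (hull a A) (hull a B))).
Proof.
have impE := hull_id (aura_imp_open (hull a A) (hull a B)).
split; first by rewrite pi_meet_leE impE; apply/asboolP; exact: aura_imp_mp.
move=> s; rewrite -[s]reprK pi_meet_leE aura_leE impE => /asboolP sAB.
by apply/asboolP; apply: aura_imp_max => //; exact: hull_open.
Qed.

End AuraImplication.

Theorem theorem5p3 (X : topologicalType) (X_neq0 : [set: X] !=set0)
    (a : scope_function X) :
  (forall U V : set X, aura_open a U -> aura_open a V ->
    [/\ aura_open a (aura_imp a U V),
        aura_imp a U V `&` U `<=` V &
        forall W : set X, aura_open a W -> W `&` U `<=` V ->
          W `<=` aura_imp a U V]) /\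
  (forall A B : set X,
    aura_himp (\pi_(aura_quot a) A) (\pi_(aura_quot a) B) =
    \pi_(aura_quot a) (aura_imp a (hull a A) (hull a B))).
Proof.
split=> [U V _ _|A B].
  split; [exact: aura_imp_open|exact: aura_imp_mp|].
  by move=> W; exact: aura_imp_max.
by apply: is_himp_uniq; [exact: aura_himpP|exact: is_himp_aura_imp].
Qed.
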